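(* Let $n\ge 1$ and $m\ge n+2$ be integers and let $\tilde{B}=\left[\begin{smallmatrix}B\\C\end{smallmatrix}\right]$ be an $m\times n$ integer matrix of rank $n$ whose top $n\times n$ block $B$ is skew-symmetrisable. Let $D'$ be a skew-symmetriser of $B$. Let $F\subset\{1,\ldots,m\}$ be a subset of cardinality $n$ such that the submatrix $\tilde{B}_F$ has rank $n$, and let $R=\{1,\ldots,m\}\setminus F$. Then the enhanced solution matrices $\mathfrak{M}_{E(i,j)}=\mathfrak{M}_{E(i,j)}(\tilde{B})$, for $i<j$ in $R$, form a basis of the $\mathbb{Q}$-vector space of skew-symmetric matrices $\Lambda\in\operatorname{Mat}_{m\times m}(\mathbb{Q})$ satisfying $\tilde{B}^T\Lambda=0$; in particular this space has dimension $\binom{m-n}{2}$. Moreover, the set of skew-symmetric matrices $\Lambda\in\operatorname{Mat}_{m\times m}(\mathbb{Q})$ satisfying $$\tilde{B}^T\Lambda=\left[\begin{matrix}D'&0\end{matrix}\right]$$ (an $n\times n$ block followed by an $n\times(m-n)$ zero block) is non-empty, and if $\Lambda_0$ is any element of it, then every element of it is the sum of $\Lambda_0$ and a $\mathbb{Q}$-linear combination of the matrices $\mathfrak{M}_{E(i,j)}$, $i<j$ in $R$.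
   Context: An $n\times n$ integer matrix $B=(b_{i,j})$ is skew-symmetrisable if there is a diagonal matrix $D'=\operatorname{diag}(d'_1,\ldots,d'_n)$ with positive integer diagonal entries such that $D'B$ is skew-symmetric; any such $D'$ is called a skew-symmetriser of $B$. For an $m\times n$ matrix $A$ and a subset $J\subseteq\{1,\ldots,m\}$, $A_J$ denotes the submatrix of $A$ consisting of the rows indexed by $J$ (in increasing order) and all columns. Minor matrix: for an $(n+2)\times n$ integer matrix $A'$ and distinct $r,s\in\{1,\ldots,n+2\}$, let $R(r,s)=\{1,\ldots,n+2\}\setminus\{r,s\}$. Define the skew-symmetric $(n+2)\times(n+2)$ integer matrix $M(A')=(m_{r,s})$ by $m_{r,s}=(-1)^{r+s}\det(A'_{R(r,s)})$ if $r<s$, $m_{r,r}=0$, and $m_{r,s}=(-1)^{r+s+1}\det(A'_{R(r,s)})$ if $s<r$. Enhanced solution matrix: for distinct $i,j\in R$, let $E(i,j)=F\cup\{i,j\}=\{e_1<e_2<\cdots<e_{n+2}\}$ and let $M_{E(i,j)}=M(\tilde{B}_{E(i,j)})$. Then $\mathfrak{M}_{E(i,j)}$ is the $m\times m$ integer matrix whose $(e_r,e_s)$ entry is the $(r,s)$ entry of $M_{E(i,j)}$ for all $1\le r,s\le n+2$, and all of whose other entries are $0$. *)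

(* Defs.v *)
From mathcomp Require Import all_boot all_order all_algebra.

Set Implicit Arguments.
Unset Strict Implicit.
Unset Printing Implicit Defensive.

Import Order.TTheory GRing.Theory Num.Theory.
Local Open Scope ring_scope.

Definition skew_symmetric (R : nzRingType) (n : nat) (A : 'M[R]_n) : Prop :=
  A^T = - A.

Definition skew_symmetriser (n : nat) (D B : 'M[int]_n) : Prop :=
  [/\ is_diag_mx D, forall i, 0 < D i i & skew_symmetric (D *m B)].

Definition skew_symmetrisable (n : nat) (B : 'M[int]_n) : Prop :=
  exists D : 'M[int]_n, skew_symmetriser D B.

Definition ratmx (m n : nat) (A : 'M[int]_(m, n)) : 'M[rat]_(m, n) :=
  map_mx intr A.

(* The rows of A indexed by J: [enum_val] lists J in increasing order. *)
Definition rows (m n : nat) (A : 'M[int]_(m, n)) (J : {set 'I_m}) :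
  'M[int]_(#|J|, n) := rowsub (@enum_val _ (mem J)) A.

(* [rows A J] seen as a k x n matrix. It is only meaningful for #|J| = k; the
   junk value 0 is returned otherwise. *)
Definition krows (k m n : nat) (A : 'M[int]_(m, n)) (J : {set 'I_m}) :
  'M[int]_(k, n) := conform_mx 0 (rows A J).

(* Indices start at 0 here, which does not change the parity of r + s. *)
Definition minor_matrix (n : nat) (A : 'M[int]_(n.+2, n)) : 'M[int]_n.+2 :=
  \matrix_(r, s)
    if (r < s)%N then (-1) ^+ (r + s) * \det (krows n A (~: [set r; s]))
    else if (s < r)%N then
      (-1) ^+ (r + s + 1) * \det (krows n A (~: [set r; s]))
    else 0.

(* For #|E| = n + 2. If E = {e_0 < ... < e_(n+1)} then
   [index e_r (enum E) = r]. *)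
Definition enhanced (m n : nat) (A : 'M[int]_(m, n)) (E : {set 'I_m}) :
  'M[int]_m :=
  \matrix_(a, b)
    if (a \in E) && (b \in E) then
      minor_matrix (krows n.+2 A E)
        (inord (index a (enum E))) (inord (index b (enum E)))
    else 0.

(* E(i, j) is F together with both components of the pair ij = (i, j). *)
Definition Eset (m : nat) (F : {set 'I_m}) (ij : 'I_m * 'I_m) : {set 'I_m} :=
  F :|: [set ij.1; ij.2].

Definition pairs (m : nat) (F : {set 'I_m}) : {set 'I_m * 'I_m} :=
  [set ij | [&& ij.1 \in ~: F, ij.2 \in ~: F & (ij.1 < ij.2)%N]].

Definition homogeneous_space (m n : nat) (A : 'M[int]_(m, n)) :
  {vspace 'M[rat]_m} :=
  (lker (linfun (@trmx rat m m) + \1%VF : 'End('M[rat]_m))%R :&: lker (linfun (mulmx (ratmx A)^T)))%VS.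

Lemma homogeneous_spaceP (m n : nat) (A : 'M[int]_(m, n)) (L : 'M[rat]_m) :
  reflect (skew_symmetric L /\ (ratmx A)^T *m L = 0)
          (L \in homogeneous_space A).
Proof.
rewrite memv_cap !memv_ker add_lfunE id_lfunE !lfunE /= addr_eq0.
by apply: (iffP andP) => -[skL AL]; split; apply/eqP.
Qed.

(* Main.v *)
Require Import Defs.
From mathcomp Require Import all_boot all_order all_algebra.

Set Implicit Arguments.
Unset Strict Implicit.
Unset Printing Implicit Defensive.

Import Order.TTheory GRing.Theory Num.Theory.
Local Open Scope ring_scope.

(** For distinct i, j outside F, the (i, j) entry of the enhanced matrix of
    E(i, j) is, up to sign, the determinant of the rows F, hence nonzero, while
    it vanishes for the other pairs. Conversely, a homogeneous solution whose
    F^c x F^c block vanishes is zero: its columns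
    indexed by F^c are supported on F, hence zero because the rows F are
    independent; by skew-symmetry so are the rows indexed by F^c, and the
    remaining columns are supported on F again. So the F^c x F^c entries are
    coordinates with respect to the enhanced matrices. A particular solution of
    A^T L = Z, when Z A is skew-symmetric, is G Z - Z^T G^T - G (Z A) G^T for
    any right inverse G of A^T. *)

(** * Increasing enumerations of index sets *)

Definition increasing (k m : nat) (f : 'I_k -> 'I_m) :=
  forall i j : 'I_k, (i < j)%N -> (f i < f j)%N.

Lemma increasing_inj (k m : nat) (f : 'I_k -> 'I_m) :
  increasing f -> injective f.
Proof.
move=> f_incr i j eq_f; apply: val_inj => /=.
by case: (ltngtP i j) => // /f_incr; rewrite eq_f ltnn.
Qed.

Lemma increasing_comp (k l m : nat) (f : 'I_l -> 'I_m) (g : 'I_k -> 'I_l) :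
  increasing f -> increasing g -> increasing (f \o g).
Proof. by move=> f_incr g_incr i j /g_incr/f_incr. Qed.

Lemma increasing_lift (k : nat) (h : 'I_k) : increasing (lift h).
Proof. by move=> i j lt_ij; rewrite !ltnNge leq_bump2 -ltnNge. Qed.

Lemma sorted_map_enum_ord (k m : nat) (f : 'I_k -> 'I_m) :
  increasing f -> sorted ltn [seq val (f i) | i <- enum 'I_k].
Proof.
move=> f_incr.
have: sorted ltn (map val (enum 'I_k)) by rewrite val_enum_ord iota_ltn_sorted.
by rewrite !sorted_map; apply: sub_sorted => i j /f_incr.
Qed.

Lemma enum_ord_sorted (m : nat) (J : {set 'I_m}) :
  sorted ltn [seq val i | i <- enum J].
Proof.
have subJ: subseq (enum J) (enum 'I_m) by rewrite enumT; apply: filter_subseq.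
apply: (subseq_sorted ltn_trans (map_subseq val subJ)).
by rewrite val_enum_ord iota_ltn_sorted.
Qed.

(** Both lists are strictly sorted and have the same elements, so they coincide. *)
Lemma enum_increasing (k m : nat) (f : 'I_k -> 'I_m) (J : {set 'I_m}) :
  increasing f -> J = [set f i | i : 'I_k] ->
  enum J = [seq f i | i <- enum 'I_k].
Proof.
move=> f_incr ->; apply: (inj_map val_inj); rewrite -map_comp.
apply: (irr_sorted_eq ltn_trans ltnn).
- exact: enum_ord_sorted.
- exact: sorted_map_enum_ord.
move=> x; rewrite (map_comp val); apply/eq_mem_map => y.
rewrite mem_enum.
by apply/imsetP/mapP => -[i _ ->]; exists i; rewrite ?mem_enum.
Qed.

(** This frees [krows] from its cast and junk value: any increasing parametrisation of [J] may index
    the selected rows. *)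
Lemma krowsE (k m n : nat) (A : 'M[int]_(m, n)) (f : 'I_k -> 'I_m)
    (J : {set 'I_m}) :
  increasing f -> J = [set f i | i : 'I_k] -> krows k A J = rowsub f A.
Proof.
move=> f_incr defJ.
have cardJ : #|J| = k.
  by rewrite defJ card_imset ?card_ord //; apply: increasing_inj.
have enumJ := enum_increasing f_incr defJ.
(* Once [k] is replaced by [#|J|], [conform_mx] is the identity. *)
move: f f_incr defJ enumJ; case: k / cardJ => f f_incr defJ enumJ.
rewrite /krows conform_mx_id; apply/matrixP => i j; rewrite !mxE.
congr (A _ j); rewrite (enum_val_nth (f i)) enumJ.
by rewrite (nth_map i) ?size_enum_ord ?nth_ord_enum.
Qed.

(** The cast gives row selections the dimension [k] definitionally, so that square blocks have
    determinants. *)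
Definition set_enum (k m : nat) (J : {set 'I_m}) (cardJ : #|J| = k)
  (i : 'I_k) : 'I_m := enum_val (cast_ord (esym cardJ) i).

Lemma increasing_set_enum (k m : nat) (J : {set 'I_m}) (cardJ : #|J| = k) :
  increasing (set_enum cardJ).
Proof.
case: k / cardJ => i j lt_ij; rewrite /set_enum !cast_ord_id.
have x0 := enum_val i; rewrite !(enum_val_nth x0).
rewrite -!(nth_map _ 0%N val) -?cardE //.
by apply: (sorted_ltn_nth ltn_trans _ (enum_ord_sorted J));
   rewrite ?inE ?size_map -?cardE.
Qed.

Lemma set_enumP (k m : nat) (J : {set 'I_m}) (cardJ : #|J| = k) x :
  reflect (exists i, x = set_enum cardJ i) (x \in J).
Proof.
apply: (iffP idP) => [Jx|[i ->]]; last exact: enum_valP.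
exists (cast_ord cardJ (enum_rank_in Jx x)).
by rewrite /set_enum cast_ordK enum_rankK_in.
Qed.

Lemma set_enum_imset (k m : nat) (J : {set 'I_m}) (cardJ : #|J| = k) :
  J = [set set_enum cardJ i | i : 'I_k].
Proof.
apply/setP => x.
by apply/(set_enumP cardJ)/imsetP => [[i ->]|[i _ ->]]; exists i.
Qed.

Lemma index_set_enum (k m : nat) (J : {set 'I_m}) (cardJ : #|J| = k) i :
  index (set_enum cardJ i) (enum J) = i.
Proof.
rewrite {1}/set_enum (enum_val_nth (set_enum cardJ i)) index_uniq ?enum_uniq //.
by rewrite -cardE ltn_ord.
Qed.

Lemma big_set_enum (V : nmodType) (k m : nat) (J : {set 'I_m})
    (cardJ : #|J| = k) (G : 'I_m -> V) :
  \sum_(a in J) G a = \sum_(i < k) G (set_enum cardJ i).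
Proof.
rewrite {1}(set_enum_imset cardJ) big_imset //= => i j _ _.
exact/increasing_inj/increasing_set_enum.
Qed.

(** * Minor matrices: skew-symmetry and the kernel relation *)

Lemma minor_matrix_skew (n : nat) (A : 'M[int]_(n.+2, n)) :
  skew_symmetric (minor_matrix A).
Proof.
apply/matrixP => r s; rewrite !mxE setUC [(s + r)%N]addnC.
case: (ltngtP r s) => _; rewrite ?oppr0 //.
  by rewrite addn1 exprS mulN1r mulNr.
by rewrite addn1 exprS mulN1r mulNr opprK.
Qed.

(** Indexing the off-diagonal entries of a column by [lift s] merges the two sign cases, giving the
    signs of a Laplace expansion. *)
Lemma minor_matrix_lift (n : nat) (A : 'M[int]_(n.+2, n)) (s : 'I_n.+2)
    (i : 'I_n.+1) :
  minor_matrix A (lift s i) s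
    = (-1) ^+ (s + i) * \det (row' i (row' s A)).
Proof.
rewrite mxE.
have ->: krows n A (~: [set lift s i; s]) = row' i (row' s A).
  rewrite (@krowsE _ _ _ _ (lift s \o lift i)).
  - by apply/matrixP => u v; rewrite !mxE.
  - by apply: increasing_comp; apply: increasing_lift.
  apply/setP => x; rewrite !inE negb_or; apply/andP/imsetP => [[]|[u _ ->]].
    case: (unliftP s x) => [y ->|->]; last by rewrite eqxx.
    rewrite (inj_eq lift_inj) => ne_yi _.
    case: (unliftP i y) ne_yi => [u ->|->]; last by rewrite eqxx.
    by exists u.
  by rewrite /= (inj_eq lift_inj) eq_sym neq_lift eq_sym neq_lift.
(* If [s <= i], the lifted index is [i.+1]; this shift and the extra 1 in the lower-triangle
   exponent cancel modulo 2. Otherwise it is [i]. *)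
rewrite /= /bump; case: (leqP s i) => /= le_si; rewrite ?add1n ?add0n.
  rewrite ltnNge (leqW le_si) /= ltnS le_si addn1 addSn !exprS.
  by rewrite !mulN1r opprK addnC.
by rewrite le_si addnC.
Qed.

(* Up to a sign, entry (k, s) of the product is the expansion along its first
   column of the determinant of A without row s, with column k repeated in
   front. *)
Lemma mul_tr_minor_matrix (n : nat) (A : 'M[int]_(n.+2, n)) :
  A^T *m minor_matrix A = 0.
Proof.
apply/matrixP => k s; rewrite [LHS]mxE [RHS]mxE (bigD1_ord s) //=.
rewrite [minor_matrix A s s]mxE ltnn mulr0 add0r.
pose X : 'M[int]_(1 + n) := row_mx (col k (row' s A)) (row' s A).
have detX : \det X = 0.
  rewrite -det_tr.
  apply: (@determinant_alternate _ _ _ (lshift n ord0) (rshift 1 k)).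
    by apply/negP => /eqP/(congr1 val).
  by move=> i; rewrite [LHS]mxE [RHS]mxE row_mxEl row_mxEr mxE.
have: (-1) ^+ s * \det X = 0 by rewrite detX mulr0.
rewrite (expand_det_col X (lshift n ord0)) mulr_sumr => {2}<-.
apply: eq_bigr => i _; rewrite minor_matrix_lift mxE row_mxEl !mxE.
rewrite /cofactor /= addn0 exprD -!mulrA [LHS]mulrCA; congr (_ * (_ * (_ * \det _))).
apply/matrixP => u v; rewrite [RHS]mxE [RHS]mxE.
have ->: lift (lshift n (@ord0 0)) v = rshift 1 v by apply: val_inj.
by rewrite row_mxEr !mxE.
Qed.

(** * Transfer to enhanced matrices *)

Lemma enhanced_set_enum (m n : nat) (A : 'M[int]_(m, n)) (E : {set 'I_m})
    (cardE : #|E| = n.+2) r s :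
  enhanced A E (set_enum cardE r) (set_enum cardE s)
    = minor_matrix (rowsub (set_enum cardE) A) r s.
Proof.
rewrite mxE !enum_valP !index_set_enum !inord_val.
by rewrite (krowsE _ (increasing_set_enum cardE) (set_enum_imset cardE)).
Qed.

Lemma enhanced_skew (m n : nat) (A : 'M[int]_(m, n)) (E : {set 'I_m}) :
  skew_symmetric (enhanced A E).
Proof.
apply/matrixP => a b.
rewrite [LHS]mxE [RHS]mxE [LHS]mxE [X in - X]mxE andbC.
case: ifP => _; last by rewrite oppr0.
have /matrixP/(_ (inord (index a (enum E))) (inord (index b (enum E)))) :=
  minor_matrix_skew (krows n.+2 A E).
by rewrite [LHS]mxE [RHS]mxE.
Qed.

(** Columns outside [E] are zero. In a column indexed by [E] only the rows in [E] contribute, which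
    leaves the relation for the minor matrix of these rows. *)
Lemma mul_tr_enhanced (m n : nat) (A : 'M[int]_(m, n)) (E : {set 'I_m}) :
  #|E| = n.+2 -> A^T *m enhanced A E = 0.
Proof.
move=> cardE; apply/matrixP => k b; rewrite [LHS]mxE [RHS]mxE.
case Eb: (b \in E); last first.
  by apply: big1 => a _; rewrite !mxE Eb andbF mulr0.
rewrite (bigID (mem E)) /= [X in _ + X]big1 ?addr0; last first.
  by move=> a /negPf Ea; rewrite !mxE Ea mulr0.
have /(set_enumP cardE)[s ->] := Eb; rewrite (big_set_enum cardE).
have /matrixP/(_ k s) := mul_tr_minor_matrix (rowsub (set_enum cardE) A).
rewrite [LHS]mxE [RHS]mxE => {2}<-.
by apply: eq_bigr => r _; rewrite enhanced_set_enum !mxE.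
Qed.

Lemma unitmx_rowsub_set_enum (m n : nat) (A : 'M[int]_(m, n)) (F : {set 'I_m})
    (cardF : #|F| = n) :
  \rank (ratmx (rows A F)) = n ->
  ratmx (rowsub (set_enum cardF) A) \in unitmx.
Proof.
case: n / cardF A => A rankF; rewrite -row_free_unit /row_free.
suff ->: rowsub (set_enum erefl) A = rows A F by apply/eqP.
by apply/matrixP => i j; rewrite !mxE /set_enum cast_ord_id.
Qed.

(** * Coordinates on the homogeneous solutions, the basis and the dimension *)

Section Pairs.

Variables (m n : nat) (A : 'M[int]_(m, n)) (F : {set 'I_m}).
Hypothesis cardF : #|F| = n.
Hypothesis rankF : \rank (ratmx (rows A F)) = n.

Lemma supported_ker_eq0 (k : nat) (V : 'M[rat]_(m, k)) :
  (ratmx A)^T *m V = 0 -> (forall a b, a \notin F -> V a b = 0) -> V = 0.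
Proof.
move=> AV0 V0.
have unitAFt : (ratmx (rowsub (set_enum cardF) A))^T \in unitmx.
  by rewrite unitmx_tr; apply: unitmx_rowsub_set_enum.
(* Since [V] vanishes off [F], the product with the full transpose reduces to the invertible square
   block of the rows [F]. *)
have VF0: rowsub (set_enum cardF) V = 0.
  apply: (can_inj (mulKmx unitAFt)).
  rewrite mulmx0; apply/matrixP => u b.
  have /matrixP/(_ u b) := AV0; rewrite [LHS]mxE [RHS]mxE => AV0ub.
  rewrite [LHS]mxE [RHS]mxE -[RHS]AV0ub.
  rewrite (bigID (mem F)) /= [X in _ = _ + X]big1 ?addr0; last first.
    by move=> a Fa; rewrite V0 ?mulr0.
  by rewrite (big_set_enum cardF); apply: eq_bigr => r _; rewrite !mxE.
apply/matrixP => a b; rewrite [RHS]mxE.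
have [/(set_enumP cardF)[r ->]|/V0->//] := boolP (a \in F).
by have /matrixP/(_ r b) := VF0; rewrite !mxE.
Qed.

Lemma homogeneous_eq0 (L : 'M[rat]_m) :
  L \in homogeneous_space A ->
  (forall ij, ij \in pairs F -> L ij.1 ij.2 = 0) -> L = 0.
Proof.
case/homogeneous_spaceP => skL AL0 L0.
have tL a b : L a b = - L b a.
  by have /matrixP/(_ b a) := skL; rewrite !mxE.
have LR0 a b : a \notin F -> b \notin F -> L a b = 0.
  move=> Fa Fb; case: (ltngtP a b) => [lt_ab|lt_ba|/val_inj->].
  - by apply: (L0 (a, b)); rewrite !inE Fa Fb.
  - by rewrite tL (L0 (b, a)) ?oppr0 // !inE Fa Fb.
  (* On the diagonal, skew-symmetry gives twice the entry equal to 0, and the rationals have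
     characteristic 0. *)
  by apply/eqP; have /eqP := tL b b; rewrite -addr_eq0 -mulr2n mulrn_eq0.
have LcolR0 b : b \notin F -> col b L = 0.
  move=> Fb; apply: supported_ker_eq0 => [|a j Fa]; last by rewrite mxE LR0.
  by rewrite colE mulmxA AL0 mul0mx.
apply: supported_ker_eq0 => // a b Fa; rewrite tL.
by have /matrixP/(_ b 0) := LcolR0 _ Fa; rewrite !mxE => ->; rewrite oppr0.
Qed.

Lemma pairsP ij :
  reflect [/\ ij.1 \notin F, ij.2 \notin F & (ij.1 < ij.2)%N] (ij \in pairs F).
Proof. by rewrite !inE; apply: and3P. Qed.

Lemma card_Eset ij : ij \in pairs F -> #|Eset F ij| = n.+2.
Proof.
case/pairsP => F1 F2 lt12.
rewrite /Eset setUC -setUA !cardsU1 cardF !inE (negPf F1) (negPf F2) !orbF.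
by rewrite neq_ltn lt12 !add1n.
Qed.

(** A nonzero entry would require both components of [ij], which lie outside [F], to be among those
    of [kl]; the strict orders then force equality of the pairs. *)
Lemma enhanced_pair_eq0 ij kl :
  ij \in pairs F -> kl \in pairs F -> ij != kl ->
  enhanced A (Eset F kl) ij.1 ij.2 = 0.
Proof.
case: ij kl => [i j] [k l] /pairsP[/= Fi Fj lt_ij] /pairsP[/= Fk Fl lt_kl].
rewrite xpair_eqE mxE !inE (negPf Fi) (negPf Fj) /= => neq_ijkl.
case: ifP => // /andP[/orP[]/eqP eq_i /orP[]/eqP eq_j]; subst i j.
- by rewrite ltnn in lt_ij.
- by rewrite !eqxx in neq_ijkl.
- by rewrite ltnNge ltnW in lt_ij.
by rewrite ltnn in lt_ij.
Qed.

Lemma enhanced_pair_neq0 ij :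
  ij \in pairs F -> enhanced A (Eset F ij) ij.1 ij.2 != 0.
Proof.
move=> Pij; have cardE := card_Eset Pij; case/pairsP: Pij => F1 F2 lt12.
set f := set_enum cardE; have f_incr : increasing f := increasing_set_enum cardE.
have f_inj := increasing_inj f_incr.
have [r def1]: exists r, ij.1 = f r.
  by apply/set_enumP; rewrite !inE eqxx orbT.
have [s def2]: exists s, ij.2 = f s.
  by apply/set_enumP; rewrite !inE eqxx !orbT.
rewrite [X in enhanced _ _ X]def1 [X in enhanced _ _ _ X]def2 enhanced_set_enum.
case: (unliftP s r) => [u def_r|eq_rs]; last first.
  by move: lt12; rewrite def1 def2 eq_rs ltnn.
rewrite def_r minor_matrix_lift mulf_neq0 ?signr_eq0 //.
(* Deleting the positions of [ij.1] and [ij.2] from the enumeration of E(i, j) leaves an increasing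
   enumeration of [F]; by [krowsE], any two of these select the same matrix. *)
have ->: row' u (row' s (rowsub f A)) = rowsub (set_enum cardF) A.
  rewrite -(krowsE A (increasing_set_enum cardF) (set_enum_imset cardF)).
  rewrite (@krowsE _ _ _ A (f \o (lift s \o lift u))).
  - by apply/matrixP => a b; rewrite !mxE.
  - by do !apply: increasing_comp => //; apply: increasing_lift.
  apply/setP => x; apply/idP/imsetP => [Fx|[y _ ->] /=].
    have: x \in Eset F ij by rewrite inE Fx.
    case/(set_enumP cardE) => z; rewrite -/f => def_x.
    case: (unliftP s z) def_x => [v ->|->] def_x; last first.
      by rewrite def2 -def_x Fx in F2.
    case: (unliftP u v) def_x => [w ->|->] def_x; last first.
      by rewrite def1 def_r -def_x Fx in F1.
    by exists w.
  have: f (lift s (lift u y)) \in Eset F ij by apply: enum_valP.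
  rewrite !inE def1 def2 def_r !(inj_eq f_inj) (inj_eq lift_inj).
  by rewrite [_ == u]eq_sym [_ == s]eq_sym !(negPf (neq_lift _ _)) !orbF.
have := unitmx_rowsub_set_enum cardF rankF.
by rewrite unitmxE det_map_mx unitfE intr_eq0.
Qed.

Lemma enhanced_homogeneous ij :
  ij \in pairs F -> ratmx (enhanced A (Eset F ij)) \in homogeneous_space A.
Proof.
move=> Pij; apply/homogeneous_spaceP; split.
  by rewrite /skew_symmetric  map_trmx enhanced_skew map_mxN.
by rewrite map_trmx -map_mxM mul_tr_enhanced ?map_mx0 ?card_Eset.
Qed.

(** At a pair [ij], only the term of [ij] survives in the sum, and its coefficient is normalised to
    reproduce the entry of [L]. The difference of the two sides is thus homogeneous with all
    coordinates zero. *)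
Lemma homogeneous_decomp L : L \in homogeneous_space A ->
  L = \sum_(ij in pairs F)
        (L ij.1 ij.2 / ratmx (enhanced A (Eset F ij)) ij.1 ij.2)
          *: ratmx (enhanced A (Eset F ij)).
Proof.
move=> HL; apply/eqP; rewrite -subr_eq0; apply/eqP.
apply: homogeneous_eq0 => [|ij Pij].
  rewrite memvB // memv_suml // => ij Pij.
  by rewrite memvZ // enhanced_homogeneous.
rewrite mxE [X in _ + X]mxE summxE (bigD1 ij) //= big1 ?addr0;
  last move=> kl /andP[Pkl ne].
  rewrite [X in _ - X]mxE divfK ?subrr //.
  by rewrite [ratmx _ _ _]mxE intr_eq0 enhanced_pair_neq0.
by rewrite mxE [X in _ * X]mxE enhanced_pair_eq0 ?mulr0 // eq_sym.
Qed.

(** Reading a linear relation at the entry of one pair kills every other term and leaves that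
    coefficient times a nonzero number. *)
Lemma enhanced_free :
  free [seq ratmx (enhanced A (Eset F ij)) | ij <- enum (pairs F)].
Proof.
pose M ij := ratmx (enhanced A (Eset F ij)).
apply/(@freeP _ _ _ (map_tuple M (in_tuple (enum (pairs F))))) => c c0 u.
have x0 := tnth (in_tuple (enum (pairs F))) u.
pose e (v : 'I_(size (enum (pairs F)))) := nth x0 (enum (pairs F)) v.
have Pe v : e v \in pairs F by rewrite -mem_enum mem_nth.
have /matrixP/(_ (e u).1 (e u).2) := c0.
rewrite summxE (bigD1 u) //= big1 ?addr0 => [|v ne_vu].
  rewrite [LHS]mxE [RHS]mxE (nth_map x0) // -/(e u) [ratmx _ _ _]mxE.
  move/eqP; rewrite mulf_eq0 intr_eq0 (negPf (enhanced_pair_neq0 (Pe u))).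
  by rewrite orbF => /eqP.
rewrite mxE (nth_map x0) // -/(e v) [ratmx _ _ _]mxE enhanced_pair_eq0 ?mulr0 //.
by rewrite nth_uniq ?enum_uniq // eq_sym.
Qed.

Lemma enhanced_basis :
  basis_of (homogeneous_space A)
    [seq ratmx (enhanced A (Eset F ij)) | ij <- enum (pairs F)].
Proof.
rewrite /basis_of enhanced_free andbT eqEsubv; apply/andP; split.
  apply/span_subvP => _ /mapP[ij + ->].
  by rewrite mem_enum; apply: enhanced_homogeneous.
apply/subvP => L /homogeneous_decomp ->.
apply: memv_suml => ij Pij; apply: memvZ; apply: memv_span.
by apply: map_f; rewrite mem_enum.
Qed.

(** Forgetting the order is a bijection onto the 2-element subsets of the complement of [F]; the
    strict inequality recovers the order. *)
Lemma card_pairs : #|pairs F| = 'C(#|~: F|, 2).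
Proof.
rewrite -cards_draws.
have inj2: {in pairs F &, injective (fun ij => [set ij.1; ij.2])}.
  move=> [i j] [k l] /pairsP[/= _ _ lt_ij] /pairsP[/= _ _ lt_kl] eq2.
  have: k \in [set i; j] by rewrite eq2 !inE eqxx.
  have: l \in [set i; j] by rewrite eq2 !inE eqxx orbT.
  have: i \in [set k; l] by rewrite -eq2 !inE eqxx.
  have: j \in [set k; l] by rewrite -eq2 !inE eqxx orbT.
  rewrite !inE => /orP[]/eqP ej /orP[]/eqP ei; subst i j => //;
    by rewrite ?ltnn // ltnNge ltnW in lt_ij.
rewrite -(card_in_imset inj2); apply: eq_card => S; rewrite !inE.
apply/imsetP/andP => [[ij /pairsP[F1 F2 lt12] ->]|[sSF /cards2P[i [j [ne_ij eqS]]]]].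
  rewrite cards2 neq_ltn lt12; split=> //.
  by apply/subsetP => x; rewrite !inE => /orP[]/eqP->.
have [Fi Fj]: i \notin F /\ j \notin F.
  by move/subsetP: sSF => sSF; split; rewrite -in_setC sSF // eqS !inE eqxx ?orbT.
move: ne_ij; rewrite neq_ltn => /orP[lt_ij|lt_ji].
  by exists (i, j) => //; apply/pairsP.
by exists (j, i); [apply/pairsP | rewrite eqS setUC].
Qed.

End Pairs.

(** * A particular solution, and the affine solution set *)

Lemma skew_solution_exists (K : fieldType) (m n : nat) (A : 'M[K]_(m, n))
    (Z : 'M[K]_(n, m)) :
  row_free A^T -> skew_symmetric (Z *m A) ->
  exists L : 'M[K]_m, skew_symmetric L /\ A^T *m L = Z.
Proof.
case/row_freeP => G AG skZA.
have tZA: A^T *m Z^T = - (Z *m A) by rewrite -trmx_mul skZA.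
(* The first two terms form a skew matrix that [A^T] sends to [Z + Z A G^T]; the third term, skew
   because [Z A] is, removes the excess. *)
exists (G *m Z - Z^T *m G^T - G *m (Z *m A) *m G^T); split.
  rewrite /skew_symmetric !linearB /= !trmx_mul !trmxK tZA.
  by rewrite mulNmx mulmxN !opprK !mulmxA [- _ + _]addrC.
rewrite !mulmxBr !mulmxA AG !mul1mx tZA mulNmx opprK.
by rewrite -!mulmxA addrK.
Qed.

Theorem mainTheorem3 (n p : nat) (n_ge1 : (1 <= n)%N) (p_ge2 : (2 <= p)%N)
    (B : 'M[int]_n) (C : 'M[int]_(p, n)) (Bt : 'M[int]_(n + p, n))
    (defBt : Bt = col_mx B C)
    (rankBt : \rank (ratmx Bt) = n)
    (symB : skew_symmetrisable B)
    (D : 'M[int]_n) (symD : skew_symmetriser D B)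
    (F : {set 'I_(n + p)}) (cardF : #|F| = n)
    (rankF : \rank (ratmx (rows Bt F)) = n) :
  [/\ basis_of (homogeneous_space Bt)
        [seq ratmx (enhanced Bt (Eset F ij)) | ij <- enum (pairs F)],
      \dim (homogeneous_space Bt) = 'C(p, 2),
      exists L : 'M[rat]_(n + p),
        skew_symmetric L /\ (ratmx Bt)^T *m L = row_mx (ratmx D) 0
    & forall L0 : 'M[rat]_(n + p),
        skew_symmetric L0 -> (ratmx Bt)^T *m L0 = row_mx (ratmx D) 0 ->
        forall L : 'M[rat]_(n + p),
        skew_symmetric L -> (ratmx Bt)^T *m L = row_mx (ratmx D) 0 ->
        exists c : 'I_(n + p) * 'I_(n + p) -> rat,
          L = L0 + \sum_(ij in pairs F)
                     c ij *: ratmx (enhanced Bt (Eset F ij))].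
Proof.
have basisH := enhanced_basis cardF rankF; split=> //.
- have cardR : #|~: F| = p.
    by apply: (@addnI n); rewrite -{1}cardF cardsC card_ord.
  case/andP: basisH => /eqP <- /eqP ->.
  by rewrite size_map -cardE card_pairs cardR.
- apply: skew_solution_exists; first by rewrite /row_free mxrank_tr rankBt.
  (* The zero block discards [C], so the required skew-symmetry is that of [D *m B]. *)
  rewrite defBt /ratmx map_col_mx mul_row_col mul0mx addr0 -map_mxM.
  by case: symD => _ _ skDB; rewrite /skew_symmetric map_trmx skDB map_mxN.
move=> L0 skL0 BL0 L skL BL.
have HL : L - L0 \in homogeneous_space Bt.
  apply/homogeneous_spaceP; split; last by rewrite mulmxBr BL BL0 subrr.
  by rewrite /skew_symmetric linearB /= skL skL0 opprB opprK addrC.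
(* These are the coordinates of [L - L0] given by [homogeneous_decomp]. *)
exists (fun ij => (L - L0) ij.1 ij.2
                  / ratmx (enhanced Bt (Eset F ij)) ij.1 ij.2).
by rewrite -(homogeneous_decomp cardF rankF HL) addrC subrK.
Qed.
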